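(* Consider a state-dependent discrete memoryless channel $W_{Y,Z|X,S}$ with finite alphabets, i.i.d. state distribution $Q_S$, innocent symbol $x_0$, and strictly causal channel state information available only at the transmitter (encoder $X_i=f_i(M,S^{i-1})$, decoder $Y^n\mapsto\hat M$). Let $\mathcal D$ be the set of joint pmfs $P_{S,V,X,Y,Z}=Q_SP_VP_{X|V}W_{Y,Z|X,S}$, where $V$ is an auxiliary random variable on a finite alphabet with $|\mathcal V|\le|\mathcal X|$, such that $P_Z=Q_0$ and $\mathbb I(X;Y)\ge\mathbb I(V;Z)$. Let $\mathcal S=\{R\ge0:\exists P\in\mathcal D\text{ with }R\le\mathbb I(X;Y)\}$. Then the covert capacity satisfies $C_{\mathrm{SC\text{-}T}}\le\max\{x:x\in\mathcal S\}$.
   Context: Finite alphabets $\mathcal S,\mathcal X,\mathcal Y,\mathcal Z$. The channel has transition pmf $W_{Y,Z|X,S}$: input $X$, state $S$, output $Y$ at the legitimate receiver and output $Z$ at an adversary (warden). The state sequence $S^n$ is i.i.d. with pmf $Q_S$ and independent of the message; neither the legitimate receiver nor the warden knows the state. $x_0\in\mathcal X$ is a fixed innocent symbol, and $Q_0(z)=\sum_{s}Q_S(s)W_{Z|X,S}(z|x_0,s)$, assumed to have full support on $\mathcal Z$. A $(2^{nR},n)$ code consists of a message $M$ uniform on $\{1,\dots,2^{nR}\}$, an encoder and a decoder of the type specified. $P_{Z^n}$ denotes the distribution of the warden's output induced by the code. A rate $R$ is achievable if there is a sequence of $(2^{nR},n)$ codes with $\mathbb P(\hat M\ne M)\to 0$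 and $\mathbb D(P_{Z^n}\|Q_0^{\otimes n})\to 0$ as $n\to\infty$; the covert capacity is the supremum of achievable rates. Mutual informations are computed under the indicated joint pmf. *)

(* Defs.v *)
From HB Require Import structures.
From mathcomp Require Import all_boot all_order all_algebra.
From mathcomp Require Import all_classical all_reals all_analysis.
Set Implicit Arguments. Unset Strict Implicit. Unset Printing Implicit Defensive.
Import Order.TTheory GRing.Theory Num.Theory.
Import numFieldNormedType.Exports.
Local Open Scope classical_set_scope.
Local Open Scope ring_scope.

Section Covert.
Variable R : realType.

(* logarithm in base 2 (rates in bits, since codes have 2^{nR} messages) *)
Definition log2 (x : R) : R := ln x / ln 2.

Definition is_pmf (A : finType) (p : A -> R) : Prop :=
  (forall a, 0 <= p a) /\ \sum_(a : A) p a = 1.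

(* relative entropy D(P||Q), convention 0 log 0 = 0 *)
Definition KL (A : finType) (p q : A -> R) : R :=
  \sum_(a : A | p a != 0) p a * log2 (p a / q a).

Definition mutinfo (A B : finType) (p : A -> B -> R) : R :=
  \sum_(a : A) \sum_(b : B | p a b != 0)
     p a b * log2 (p a b / ((\sum_(b' : B) p a b') * (\sum_(a' : A) p a' b))).

Variables (S X Y Z : finType).
(* channel W x s y z = W_{Y,Z|X,S}(y,z|x,s) *)
Variable W : X -> S -> Y -> Z -> R.
Variable QS : S -> R.
Variable x0 : X.

Definition is_channel : Prop :=
  forall x s, is_pmf (fun yz : Y * Z => W x s yz.1 yz.2).

Definition Q0 (z : Z) : R := \sum_(s : S) QS s * \sum_(y : Y) W x0 s y z.

Definition nmsg (n : nat) (r : R) : nat := `| Num.ceil ((2 : R) `^ (n%:R * r)) |%N.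

Record sc_code (n M : nat) := SCCode {
  enc : 'I_n -> 'I_M -> {ffun 'I_n -> S} -> X;
  dec : {ffun 'I_n -> Y} -> 'I_M;
  enc_strictly_causal : forall (i : 'I_n) (m : 'I_M) (s s' : {ffun 'I_n -> S}),
      (forall j : 'I_n, (j < i)%N -> s j = s' j) -> enc i m s = enc i m s'
}.

Section CodeDist.
Variables (n M : nat) (c : sc_code n M).

Definition code_joint (m : 'I_M) (s : {ffun 'I_n -> S})
    (y : {ffun 'I_n -> Y}) (z : {ffun 'I_n -> Z}) : R :=
  (M%:R)^-1 * \prod_(i : 'I_n) (QS (s i) * W (enc c i m s) (s i) (y i) (z i)).

Definition err_prob : R :=
  \sum_(m : 'I_M) \sum_(s : {ffun 'I_n -> S}) \sum_(y : {ffun 'I_n -> Y})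
    \sum_(z : {ffun 'I_n -> Z}) (if dec c y != m then code_joint m s y z else 0).

Definition PZn (z : {ffun 'I_n -> Z}) : R :=
  \sum_(m : 'I_M) \sum_(s : {ffun 'I_n -> S}) \sum_(y : {ffun 'I_n -> Y})
    code_joint m s y z.

Definition Q0n (z : {ffun 'I_n -> Z}) : R := \prod_(i : 'I_n) Q0 (z i).

End CodeDist.

Definition sc_achievable (r : R) : Prop :=
  exists c : forall n : nat, sc_code n (nmsg n r),
    (fun n => err_prob (c n)) @ \oo --> (0 : R) /\
    (fun n => KL (PZn (c n)) (Q0n (n:=n))) @ \oo --> (0 : R).

(* the set D: joint pmfs Q_S P_V P_{X|V} W with |V| = k <= |X|,
   P_Z = Q0 and I(X;Y) >= I(V;Z); PXV x v = P_{X|V}(x|v) *)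
Section Aux.
Variables (k : nat) (PV : 'I_k -> R) (PXV : X -> 'I_k -> R).

Definition aux_joint (s : S) (v : 'I_k) (x : X) (y : Y) (z : Z) : R :=
  QS s * PV v * PXV x v * W x s y z.

Definition PXY (x : X) (y : Y) : R :=
  \sum_(s : S) \sum_(v : 'I_k) \sum_(z : Z) aux_joint s v x y z.
Definition PVZ (v : 'I_k) (z : Z) : R :=
  \sum_(s : S) \sum_(x : X) \sum_(y : Y) aux_joint s v x y z.
Definition PZ (z : Z) : R := \sum_(v : 'I_k) PVZ v z.

Definition in_D : Prop :=
  (k <= #|X|)%N /\ is_pmf PV /\ (forall v, is_pmf (fun x => PXV x v)) /\
  (forall z, PZ z = Q0 z) /\ mutinfo PVZ <= mutinfo PXY.
End Aux.

End Covert.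

(* Main.v *)
Require Import Defs.
From mathcomp Require Import all_boot all_order all_algebra.
From mathcomp Require Import all_classical all_reals all_analysis.
From mathcomp Require Import ring lra.
Import Order.TTheory GRing.Theory Num.Theory.
Local Open Scope ring_scope.

(** A constant [V] makes [I(V;Z) = 0], so it suffices to find an input law [P]
    with output law [Q0] at the warden and [r <= I(X;Y)].  A code of length [n]
    induces the occupation measure [N x = sum_i P(X_i = x)].  Since [X_i] depends
    on the message and on strictly past states only, [S_i] is independent of
    [X_i], and expectations of additive functions of the letters are linear in
    [N].  Applying [ln t <= t - 1] to suitable densities gives, for every positive
    pmf [q] on [Y] and every [g > 0] with [sum_z Q0 z * g z = 1],
      [(1 - err) ln M - ln 2 <= sum_x N x * D(W_{Y|x} || q)],
      [sum_x N x * E(ln g(Z) | x) <= ln 2 * KL(P_{Z^n} || Q0^n)].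
    After division by [n] these pass to a limit [P] of [N / n] along an
    ultrafilter.  Taking [g = (P_Z / Q0 + 1) / 2] forces [P_Z = Q0]; taking [q]
    close to the output law [P_Y] gives [r <= I(X;Y)]. *)

(** * Sums over words of products of letterwise factors *)

Section ProductSums.
Context {R : realType}.

Definition upd {A : finType} {n : nat} (w : {ffun 'I_n -> A}) (k : 'I_n) (a : A) :
  {ffun 'I_n -> A} := [ffun j => if j == k then a else w j].

Lemma upd_same {A : finType} {n} (w : {ffun 'I_n -> A}) k a : upd w k a k = a.
Proof. by rewrite ffunE eqxx. Qed.

Lemma upd_other {A : finType} {n} (w : {ffun 'I_n -> A}) k a j :
  j != k -> upd w k a j = w j.
Proof. by rewrite ffunE => /negbTE ->. Qed.

(** Exchanging the [k]-th letter of [w] with an extra letter [a] is an involution on the pairs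
    [(w, a)]; the extra letter is paid for by the unit mass of [u]. *)
Lemma sum_resample {A : finType} {n} (k : 'I_n) {u : A -> R}
    (H : {ffun 'I_n -> A} -> R) : \sum_a u a = 1 ->
  \sum_w H w = \sum_(w : {ffun 'I_n -> A}) u (w k) * \sum_a H (upd w k a).
Proof.
move=> u1.
pose swap (p : {ffun 'I_n -> A} * A) := (upd p.1 k p.2, p.1 k).
have swapK : involutive swap.
  move=> [w a]; rewrite /swap /= upd_same; congr pair.
  by apply/ffunP => j; rewrite !ffunE; case: eqP => // ->.
under [RHS]eq_bigr do rewrite mulr_sumr.
rewrite pair_big /= (reindex_inj (inv_inj swapK)) /=.
rewrite -(pair_bigA _ (fun w a => u (upd w k a k) * H (upd (upd w k a) k (w k)))) /=.
apply: eq_bigr => w _; rewrite -[LHS]mul1r -u1 mulr_suml.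
apply: eq_bigr => a _; rewrite upd_same; congr (_ * H _).
by apply/ffunP => j; rewrite !ffunE; case: eqP => // ->.
Qed.

Lemma sum_causal_prod_le1 {A : finType} {n} (u : A -> R)
    (K : 'I_n -> {ffun 'I_n -> A} -> R) :
  is_pmf u -> (forall i w, 0 <= K i w) ->
  (forall (i : 'I_n) (w w' : {ffun 'I_n -> A}), (forall j : 'I_n, (j <= i)%N -> w j = w' j) -> K i w = K i w') ->
  (forall i (w : {ffun 'I_n -> A}), \sum_a K i (upd w i a) <= 1) ->
  \sum_w \prod_i K i w <= 1.
Proof.
move=> [u_ge0 u1] K_ge0 K_causal K1.
(* Hybrid argument: the factors of index at least [k] are replaced by [u]. *)
suff H k : (k <= n)%N ->
    \sum_w \prod_(i < n) (if (i < k)%N then K i w else u (w i)) <= 1.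
  rewrite (le_trans _ (H n (leqnn n))) //.
  by apply: ler_sum => w _; under [leRHS]eq_bigr do rewrite ltn_ord.
elim: k => [_|k IH kn].
  by rewrite -(bigA_distr_bigA (fun _ : 'I_n => u)) big1.
apply: le_trans (IH (ltnW kn)); pose k' := Ordinal kn.
rewrite (sum_resample k' _ u1); apply: ler_sum => w _.
(* After letter [k'] is resampled only the factor [K k'] sees the new letter: earlier factors ignore
   it by causality, and later ones are [u] of other letters. *)
pose F (w : {ffun 'I_n -> A}) := \prod_(i < n | i != k') (if (i < k)%N then K i w else u (w i)).
have FE a : \prod_(i < n) (if (i < k.+1)%N then K i (upd w k' a) else u (upd w k' a i))
     = K k' (upd w k' a) * F w.
  rewrite (bigD1 k') //= ltnSn; congr (_ * _); apply: eq_bigr => i ik.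
  have neq : (i : nat) != k by [].
  rewrite ltnS leq_eqVlt (negbTE neq) /=; case: ifP => ltik; last by rewrite upd_other.
  apply: K_causal => j ji; rewrite upd_other // -val_eqE /=.
  by rewrite neq_ltn (leq_ltn_trans ji ltik).
under eq_bigr do rewrite FE.
rewrite -mulr_suml (bigD1 k') //= ltnn -/(F w).
apply: ler_wpM2l => //; rewrite ler_piMl // prodr_ge0 // => i _.
by case: ifP.
Qed.

Lemma sum_ffun2_prod {B C : finType} {n} (G : 'I_n -> B -> C -> R) :
  \sum_(y : {ffun 'I_n -> B}) \sum_(z : {ffun 'I_n -> C}) \prod_i G i (y i) (z i)
  = \prod_i \sum_b \sum_c G i b c.
Proof.
rewrite bigA_distr_bigA; apply: eq_bigr => y _.
by rewrite bigA_distr_bigA.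
Qed.

Lemma sum_ffun2_marginal {B C : finType} {n} (p : 'I_n -> B -> C -> R)
    (i : 'I_n) (g : B -> C -> R) :
  (forall j, \sum_b \sum_c p j b c = 1) ->
  \sum_(y : {ffun 'I_n -> B}) \sum_(z : {ffun 'I_n -> C})
     (\prod_j p j (y j) (z j)) * g (y i) (z i)
  = \sum_b \sum_c p i b c * g b c.
Proof.
move=> p1.
transitivity (\sum_(y : {ffun 'I_n -> B}) \sum_(z : {ffun 'I_n -> C})
   \prod_j (p j (y j) (z j) * (if j == i then g (y j) (z j) else 1))).
  apply: eq_bigr => y _; apply: eq_bigr => z _.
  by rewrite big_split /= -big_mkcond big_pred1_eq.
rewrite (sum_ffun2_prod (fun j b c => p j b c * (if j == i then g b c else 1))).
rewrite (bigD1 i) //= eqxx [X in _ * X]big1 ?mulr1 // => j ji.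
rewrite (negbTE ji) -[RHS](p1 j).
by apply: eq_bigr => b _; apply: eq_bigr => c _; rewrite mulr1.
Qed.

End ProductSums.

(** * The occupation measure of a code *)

Section Occupation.
Context {R : realType} {S X Y Z : finType}.
Variables (W : X -> S -> Y -> Z -> R) (QS : S -> R).
Hypotheses (QS_pmf : is_pmf QS) (W_channel : is_channel W).

Let QS_ge0 s : 0 <= QS s. Proof. by case: QS_pmf. Qed.
Let QS1 : \sum_s QS s = 1. Proof. by case: QS_pmf. Qed.

Lemma channel_ge0 x s y z : 0 <= W x s y z.
Proof. by case: (W_channel x s) => /(_ (y, z)). Qed.

Lemma channel_sum1 x s : \sum_y \sum_z W x s y z = 1.
Proof. by case: (W_channel x s) => _ <-; rewrite pair_big. Qed.

(* Conditional expectation of [psi X Y Z] given [X = x]. *)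
Definition avgE (psi : X -> Y -> Z -> R) (x : X) : R :=
  \sum_s QS s * \sum_y \sum_z W x s y z * psi x y z.

Section OneCode.
Context {n M : nat} (c : sc_code S X Y n M).

Definition code_expect (h : 'I_M -> {ffun 'I_n -> S} -> {ffun 'I_n -> Y} ->
    {ffun 'I_n -> Z} -> R) : R :=
  \sum_m \sum_s \sum_y \sum_z code_joint W QS c m s y z * h m s y z.

Definition occupation (x : X) : R :=
  \sum_(m : 'I_M) \sum_(s : {ffun 'I_n -> S})
    M%:R^-1 * (\prod_j QS (s j)) * \sum_i (enc c i m s == x)%:R.

Lemma code_joint_ge0 m s y z : 0 <= code_joint W QS c m s y z.
Proof.
apply: mulr_ge0; first by rewrite invr_ge0.
by apply: prodr_ge0 => i _; rewrite mulr_ge0 // channel_ge0.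
Qed.

(** Strictness of the causality is used here: the current state does not affect the current input,
    so [S_i] is independent of [X_i]. *)
Lemma enc_upd (i : 'I_n) m s a : enc c i m (upd s i a) = enc c i m s.
Proof.
apply: enc_strictly_causal => j ji; rewrite upd_other //.
by rewrite -val_eqE neq_ltn ji.
Qed.

(** Given message and states the output letters are independent, so all but the [i]-th sum out.
    Resampling the [i]-th state then leaves the input unchanged and averages the channel over a
    fresh state of law [QS]. *)
Lemma code_expect_letter i (psi : X -> Y -> Z -> R) :
  code_expect (fun m s y z => psi (enc c i m s) (y i) (z i)) =
  \sum_(m : 'I_M) \sum_(s : {ffun 'I_n -> S})
    M%:R^-1 * (\prod_j QS (s j)) * avgE psi (enc c i m s).
Proof.
apply: eq_bigr => m _.
pose h x a := \sum_y \sum_z W x a y z * psi x y z.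
transitivity (\sum_(s : {ffun 'I_n -> S})
   M%:R^-1 * (\prod_j QS (s j)) * h (enc c i m s) (s i)).
  apply: eq_bigr => s _; rewrite /code_joint /h.
  have /= <- := sum_ffun2_marginal (fun j => W (enc c j m s) (s j)) i
    (psi (enc c i m s)) (fun j => channel_sum1 _ _).
  rewrite mulr_sumr; apply: eq_bigr => y _; rewrite mulr_sumr.
  by apply: eq_bigr => z _; rewrite big_split /= !mulrA.
rewrite (sum_resample i _ QS1); apply: eq_bigr => s _ /=.
pose F := \prod_(j < n | j != i) QS (s j).
under eq_bigr => a _.
  rewrite enc_upd upd_same (bigD1 i) //= upd_same.
  rewrite [\prod_(j < n | _) _](_ : _ = F); last first.
    by apply: eq_bigr => j ji; rewrite upd_other.
  over.
rewrite /avgE [in RHS](bigD1 i) //= -/F !mulr_sumr.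
by apply: eq_bigr => a _; rewrite /h; ring.
Qed.

Lemma code_expect_letters (psi : X -> Y -> Z -> R) :
  code_expect (fun m s y z => \sum_i psi (enc c i m s) (y i) (z i)) =
  \sum_x occupation x * avgE psi x.
Proof.
transitivity (\sum_(i < n) code_expect (fun m s y z => psi (enc c i m s) (y i) (z i))).
  rewrite /code_expect [RHS]exchange_big; apply: eq_bigr => m _ /=.
  rewrite [RHS]exchange_big; apply: eq_bigr => s _ /=.
  rewrite [RHS]exchange_big; apply: eq_bigr => y _ /=.
  by rewrite [RHS]exchange_big; apply: eq_bigr => z _ /=; rewrite mulr_sumr.
transitivity (\sum_x \sum_(m : 'I_M) \sum_(s : {ffun 'I_n -> S})
    M%:R^-1 * (\prod_j QS (s j)) * \sum_i (enc c i m s == x)%:R * avgE psi x).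
  under eq_bigr do rewrite code_expect_letter.
  rewrite exchange_big [RHS]exchange_big; apply: eq_bigr => m _ /=.
  rewrite exchange_big [RHS]exchange_big; apply: eq_bigr => s _ /=.
  rewrite -!mulr_sumr [in RHS]exchange_big /=; congr (_ * _).
  apply: eq_bigr => i _; rewrite (bigD1 (enc c i m s)) //= eqxx mul1r.
  by rewrite big1 ?addr0 // => x /negbTE; rewrite eq_sym => ->; rewrite mul0r.
apply: eq_bigr => x _; rewrite mulr_suml; apply: eq_bigr => m _.
by rewrite mulr_suml; apply: eq_bigr => s _; rewrite -mulr_suml mulrA.
Qed.

Lemma occupation_ge0 x : 0 <= occupation x.
Proof.
do 2![apply: sumr_ge0 => ? _]; apply: mulr_ge0; last exact: sumr_ge0.
by rewrite mulr_ge0 ?invr_ge0 // prodr_ge0.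
Qed.

Hypothesis M_gt0 : (0 < M)%N.

Lemma sum_uniform_iid :
  \sum_(m : 'I_M) \sum_(s : {ffun 'I_n -> S}) M%:R^-1 * \prod_j QS (s j) = 1 :> R.
Proof.
under eq_bigr do rewrite -mulr_sumr -(bigA_distr_bigA (fun _ : 'I_n => QS)) big1 // mulr1.
by rewrite sumr_const card_ord -[LHS]mulr_natr mulVf // pnatr_eq0 -lt0n.
Qed.

Lemma code_expect1 : code_expect (fun _ _ _ _ => 1) = 1.
Proof.
rewrite -[RHS]sum_uniform_iid; apply: eq_bigr => m _; apply: eq_bigr => s _.
have sum1 : \prod_j \sum_y \sum_z W (enc c j m s) (s j) y z = 1.
  by apply: big1 => j _; apply: channel_sum1.
rewrite -[RHS]mulr1 -[X in _ = _ * X]sum1.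
rewrite -sum_ffun2_prod mulr_sumr; apply: eq_bigr => y _; rewrite mulr_sumr.
by apply: eq_bigr => z _; rewrite /code_joint big_split /= mulr1 mulrA.
Qed.

Lemma occupation_sum : \sum_x occupation x = n%:R.
Proof.
transitivity (\sum_(m : 'I_M) \sum_(s : {ffun 'I_n -> S})
    M%:R^-1 * (\prod_j QS (s j)) * n%:R); last first.
  under eq_bigr do rewrite -mulr_suml.
  by rewrite -mulr_suml sum_uniform_iid mul1r.
rewrite exchange_big; apply: eq_bigr => m _ /=.
rewrite exchange_big; apply: eq_bigr => s _ /=.
rewrite -mulr_sumr exchange_big /=; congr (_ * _).
transitivity (\sum_(i < n) (1 : R)); last by rewrite sumr_const card_ord.
apply: eq_bigr => i _.
rewrite (bigD1 (enc c i m s)) //= eqxx big1 ?addr0 // => x.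
by rewrite eq_sym => /negbTE ->.
Qed.

End OneCode.
End Occupation.

(** * Logarithm inequalities *)

Lemma ln_le_sub1 {R : realType} (t : R) : 0 < t -> ln t <= t - 1.
Proof.
move=> t0; have -> : ln t = ln (1 + (t - 1)) by congr ln; ring.
by apply: le_ln1Dx; lra.
Qed.

Lemma ln_prod {R : realType} {I : finType} (F : I -> R) :
  (forall i, 0 < F i) -> ln (\prod_i F i) = \sum_i ln (F i).
Proof.
move=> F0; suff [] : 0 < \prod_i F i /\ ln (\prod_i F i) = \sum_i ln (F i) by [].
elim/big_rec2: _ => [|i x y _ [y0 IH]]; first by rewrite ln1.
by rewrite mulr_gt0 // lnM ?IH // posrE.
Qed.

(** * Reliability and covertness inequalities for one code *)

Section CodeInequalities.
Context {R : realType} {S X Y Z : finType}.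
Variables (W : X -> S -> Y -> Z -> R) (QS : S -> R).
Hypotheses (QS_pmf : is_pmf QS) (W_channel : is_channel W).

Let QS_ge0 s : 0 <= QS s. Proof. by case: QS_pmf. Qed.
Let QS1 : \sum_s QS s = 1. Proof. by case: QS_pmf. Qed.
Let W_ge0 := channel_ge0 W W_channel.

Definition outY (x : X) (y : Y) : R := \sum_s QS s * \sum_z W x s y z.

Lemma outY_ge0 x y : 0 <= outY x y.
Proof. by apply: sumr_ge0 => s _; rewrite mulr_ge0 // sumr_ge0. Qed.

Lemma outY_gt0 x s y z : 0 < QS s * W x s y z -> 0 < outY x y.
Proof.
move=> h; apply: (lt_le_trans h); rewrite /outY (bigD1 s) //= (bigD1 z) //= mulrDr.
by rewrite -addrA lerDl addr_ge0 ?mulr_ge0 ?sumr_ge0 // => ? _; rewrite mulr_ge0 // sumr_ge0.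
Qed.

Section OneCode.
Context {n M : nat} (c : sc_code S X Y n M).
Hypothesis M_gt0 : (0 < M)%N.
Let joint := code_joint W QS c.
Let ex := code_expect W QS c.
Let joint_ge0 := code_joint_ge0 W QS QS_pmf W_channel c.

(** The comparison is weighted by [joint], so nothing has to be checked where the joint law vanishes
    and a density under a logarithm may be zero. *)
Lemma code_expect_le h h' :
  (forall m s y z, joint m s y z * h m s y z <= joint m s y z * h' m s y z) ->
  ex h <= ex h'.
Proof. by move=> hh; do 4![apply: ler_sum => ? _]. Qed.

Lemma code_expectB h h' :
  ex (fun m s y z => h m s y z - h' m s y z) = ex h - ex h'.
Proof.
rewrite /ex /code_expect -sumrB; apply: eq_bigr => m _.
rewrite -sumrB; apply: eq_bigr => s _; rewrite -sumrB; apply: eq_bigr => y _.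
by rewrite -sumrB; apply: eq_bigr => z _; rewrite mulrBr.
Qed.

Lemma code_expectZr h a : ex (fun m s y z => h m s y z * a) = ex h * a.
Proof.
rewrite /ex /code_expect mulr_suml; apply: eq_bigr => m _.
rewrite mulr_suml; apply: eq_bigr => s _; rewrite mulr_suml; apply: eq_bigr => y _.
by rewrite mulr_suml; apply: eq_bigr => z _; rewrite mulrA.
Qed.

Lemma err_probE : err_prob W QS c = ex (fun m _ y _ => (dec c y != m)%:R).
Proof.
do 4![apply: eq_bigr => ? _]; rewrite /= -/joint.
by case: ifP => _; rewrite ?mulr1 ?mulr0.
Qed.

Lemma err_prob_le1 : err_prob W QS c <= 1.
Proof.
rewrite err_probE -[leRHS](code_expect1 W QS QS_pmf W_channel c M_gt0).
apply: code_expect_le => m s y z; rewrite ler_wpM2l ?joint_ge0 //.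
by case: (_ != _).
Qed.

Lemma code_joint_gt0_letter m s y z i :
  0 < joint m s y z -> 0 < QS (s i) * W (enc c i m s) (s i) (y i) (z i).
Proof.
rewrite !lt_def => /andP[+ _]; rewrite mulr_ge0 // andbT.
by apply: contra => /eqP h; rewrite /joint /code_joint (bigD1 i) //= h mul0r mulr0.
Qed.

(* The factors of the reweighted law are [q] times the posterior of [S_i] given
   [(X_i, Y_i)]; by causality the state sequence sums out last letter first. *)
Lemma sum_joint_reweighted (q : Y -> R) m y : (forall b, 0 < q b) ->
  \sum_s \sum_z joint m s y z * \prod_i (q (y i) / outY (enc c i m s) (y i))
  <= M%:R^-1 * \prod_i q (y i).
Proof.
move=> q0.
pose K i (s : {ffun 'I_n -> S}) :=
  QS (s i) * (\sum_d W (enc c i m s) (s i) (y i) d) / outY (enc c i m s) (y i).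
have -> : \sum_s \sum_z joint m s y z * \prod_i (q (y i) / outY (enc c i m s) (y i))
    = M%:R^-1 * (\prod_i q (y i)) * \sum_s \prod_i K i s.
  rewrite mulr_sumr; apply: eq_bigr => s _.
  rewrite -mulr_suml -mulr_sumr -(bigA_distr_bigA (fun i d =>
    QS (s i) * W (enc c i m s) (s i) (y i) d)) -!mulrA -!big_split /=.
  congr (_ * _); apply: eq_bigr => i _; rewrite /K -mulr_sumr; ring.
apply: ler_piMr; first by rewrite mulr_ge0 ?invr_ge0 ?prodr_ge0 // => i _; apply: ltW.
apply: (sum_causal_prod_le1 _ _ QS_pmf).
- by move=> i s; rewrite divr_ge0 ?outY_ge0 // mulr_ge0 // sumr_ge0.
- move=> i s s' ss'; rewrite /K ss' //.
  have -> // : enc c i m s = enc c i m s'.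
  by apply: enc_strictly_causal => j /ltnW; apply: ss'.
- move=> i s; rewrite /K.
  under eq_bigr do rewrite enc_upd upd_same.
  rewrite -mulr_suml -/(outY _ _).
  (* At an output letter of probability zero the quotient is 0 by the convention for division, so
     the sum is 0 there and 1 elsewhere. *)
  have [->|o0] := eqVneq (outY (enc c i m s) (y i)) 0; first by rewrite mul0r.
  by rewrite divff.
Qed.

(** Change of measure: reweighting by [T] gives a law whose marginal on message and output word is
    dominated by the uniform law times the product of the [q], under which decoding is a blind
    guess. The bound [ln t <= t - 1] at [t = g * T] compares the two laws. *)
Lemma converse_ineq (q : Y -> R) : (forall y, 0 < q y) -> \sum_y q y = 1 ->
  (1 - err_prob W QS c) * ln M%:R - ln 2 <=
  \sum_x occupation QS c x * avgE W QS (fun x y _ => ln (outY x y / q y)) x.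
Proof.
move=> q0 q1.
have M0 : 0 < M%:R :> R by rewrite ltr0n.
rewrite -(code_expect_letters W QS QS_pmf W_channel c) -/ex.
pose T m (s : {ffun 'I_n -> S}) (y : {ffun 'I_n -> Y}) :=
  \prod_i (q (y i) / outY (enc c i m s) (y i)).
(* [g] averages the likelihood ratio testing for correct decoding with the
   constant 1, which keeps it positive. *)
pose g (m : 'I_M) y : R := (M%:R * (dec c y == m)%:R + 1) / 2.
have g0 m y : 0 < g m y by rewrite divr_gt0 // ltr_wpDl // mulr_ge0.
have step1 : ex (fun m s y z => ln (g m y) -
     \sum_i ln (outY (enc c i m s) (y i) / q (y i))) <=
   ex (fun m s y z => g m y * T m s y - 1).
  apply: code_expect_le => m s y z.
  have := joint_ge0 m s y z; rewrite -/joint le_eqVlt => /predU1P[<-|j0].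
    by rewrite !mul0r.
  have o0 i : 0 < outY (enc c i m s) (y i).
    exact: outY_gt0 (code_joint_gt0_letter m s y z i j0).
  have T0 i : 0 < q (y i) / outY (enc c i m s) (y i) by rewrite divr_gt0.
  rewrite ler_wpM2l ?joint_ge0 //; apply: le_trans (ln_le_sub1 _ _); last first.
    by rewrite mulr_gt0 // prodr_gt0.
  rewrite lnM ?posrE // ?prodr_gt0 // lerD2l ln_prod // -sumrN.
  by apply: ler_sum => i _; rewrite -lnV ?posrE ?divr_gt0 // invf_div.
(* Under the uniform law on messages, independent of [y], the test [g] has mean
   [(M + M) / 2 / M = 1]. *)
have step2 : ex (fun m s y z => g m y * T m s y) <= 1.
  apply: (@le_trans _ _ (\sum_m \sum_y g m y * (M%:R^-1 * \prod_i q (y i)))).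
    apply: ler_sum => m _; rewrite exchange_big; apply: ler_sum => y _ /=.
    apply: le_trans (ler_wpM2l (ltW (g0 m y)) (sum_joint_reweighted q m y q0)).
    rewrite mulr_sumr; apply: ler_sum => s _; rewrite mulr_sumr.
    by apply: ler_sum => z _; rewrite mulrCA.
  rewrite exchange_big /= -[leRHS](@big1 R 1 *%R 'I_n (index_enum _) predT
    (fun=> \sum_y q y)) // bigA_distr_bigA.
  apply: ler_sum => y _; rewrite -mulr_suml -mulr_suml big_split /= -mulr_sumr.
  rewrite (bigD1 (dec c y)) //= eqxx big1 ?addr0; last first.
    by move=> m; rewrite eq_sym => /negbTE ->.
  rewrite sumr_const card_ord mulr1 mulrA -[(_ + _) / 2](_ : M%:R = _).
    by rewrite divff ?mul1r // gt_eqF.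
  by field.
(* The test is at least [M / 2] when decoding is correct and equals [1 / 2] otherwise; this is the
   origin of the loss [ln 2]. *)
have step3 : (1 - err_prob W QS c) * ln M%:R - ln 2 <= ex (fun m s y z => ln (g m y)).
  have one : ex (fun _ _ _ _ => 1) = 1 by apply: code_expect1.
  have -> : (1 - err_prob W QS c) * ln M%:R - ln 2 =
      ex (fun m _ y _ => (1 - (dec c y != m)%:R) * ln M%:R - 1 * ln 2).
    by rewrite code_expectB !code_expectZr code_expectB one err_probE mul1r.
  apply: code_expect_le => m s y z; rewrite ler_wpM2l ?joint_ge0 //.
  rewrite mul1r /g; case: eqP => _ /=; last first.
    by rewrite subrr mul0r sub0r mulr0 add0r mul1r lnV ?posrE.
  rewrite subr0 mul1r mulr1 ln_div ?posrE ?addr_gt0 // lerD2r.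
  by rewrite ler_ln ?posrE ?addr_gt0 // lerDl.
have one : ex (fun _ _ _ _ => 1) = 1 by apply: code_expect1.
move: step1; rewrite 2!code_expectB one => step1.
by rewrite -subr_ge0; move: step1 step2 step3; lra.
Qed.

Variable x0 : X.

(** This is the variational lower bound on relative entropy, tested on the product of the [g (z i)],
    which has mean 1 under [Q0n]. The factor [ln 2] converts bits to nats. *)
Lemma covert_ineq (g : Z -> R) : (forall z, 0 < Q0 W QS x0 z) ->
  (forall z, 0 < g z) -> \sum_z Q0 W QS x0 z * g z = 1 ->
  \sum_x occupation QS c x * avgE W QS (fun _ _ z => ln (g z)) x <=
  ln 2 * KL (PZn W QS c) (Q0n W QS x0 (n:=n)).
Proof.
move=> Q0_gt0 g0 g1.
rewrite -(code_expect_letters W QS QS_pmf W_channel c) -/ex.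
have sumPZ (h : {ffun 'I_n -> Z} -> R) :
    ex (fun _ _ _ z => h z) = \sum_z PZn W QS c z * h z.
  rewrite /PZn; under [RHS]eq_bigr do rewrite mulr_suml.
  rewrite [RHS]exchange_big; apply: eq_bigr => m _ /=.
  under [RHS]eq_bigr do rewrite mulr_suml.
  rewrite [RHS]exchange_big; apply: eq_bigr => s _ /=.
  under [RHS]eq_bigr do rewrite mulr_suml.
  by rewrite [RHS]exchange_big.
rewrite sumPZ.
have P1 : \sum_z PZn W QS c z = 1.
  rewrite -(code_expect1 W QS QS_pmf W_channel c M_gt0) -/ex sumPZ.
  by apply: eq_bigr => z _; rewrite mulr1.
have P_ge0 z : 0 <= PZn W QS c z by do 3![apply: sumr_ge0 => ? _].
have Q1 : \sum_(z : {ffun 'I_n -> Z}) Q0n W QS x0 z * \prod_i g (z i) = 1.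
  under eq_bigr do rewrite -big_split.
  by rewrite -(bigA_distr_bigA (fun _ : 'I_n => fun d => Q0 W QS x0 d * g d)) big1.
(* Adding this null sum to the right-hand side makes the inequality hold term by term, again by
   [ln t <= t - 1]. *)
have zero : \sum_z (Q0n W QS x0 z * \prod_i g (z i) - PZn W QS c z) = 0.
  by rewrite sumrB Q1 P1 subrr.
rewrite /KL [X in ln 2 * X]big_mkcond mulr_sumr -[leRHS]addr0 -[X in _ + X]zero -big_split.
apply: ler_sum => z _ /=.
have Qz : 0 < Q0n W QS x0 z by apply: prodr_gt0.
have gz : 0 < \prod_i g (z i) by apply: prodr_gt0.
case: eqP => [->|/eqP Pn0] /=; first by rewrite mul0r mulr0 add0r subr0 mulr_ge0 ?ltW.
have P0 : 0 < PZn W QS c z by rewrite lt_def Pn0 P_ge0.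
rewrite -ln_prod // /log2 mulrCA [ln 2 * _]mulrC divfK; last by rewrite gt_eqF // ln_gt0 // ltr1n.
rewrite -lerBlDl -mulrBr.
set P := PZn W QS c z in P0 *; set Q := Q0n W QS x0 z in Qz *.
have -> : Q * \prod_i g (z i) - P = P * ((\prod_i g (z i)) / (P / Q) - 1).
  by field; rewrite !gt_eqF.
rewrite ler_pM2l // -ln_div ?posrE ?divr_gt0 //.
by apply: ln_le_sub1; rewrite !divr_gt0.
Qed.

End OneCode.
End CodeInequalities.

(** * Passage to the limit in the blocklength *)

Section Limit.
Local Open Scope classical_set_scope.
Import numFieldNormedType.Exports.

(** Compactness of the segment gives a cluster point, and a cluster point of an ultrafilter is a
    limit, since the ultrafilter contains each preimage or its complement. *)
Lemma ultra_cvg_unit_interval {R : realType} {T : Type} {U : set_system T}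
    {U_ultra : UltraFilter U} (f : T -> R) :
  (forall n, 0 <= f n <= 1) -> exists p : R, f @ U --> p.
Proof.
move=> f01.
have [p [_ clp]] := @segment_compact R 0 1 (f @ U) _
  (filterS (fun n _ => f01 n) (@filterT _ U _)).
exists p => A Ap; have [//|UA] := in_ultra_setVsetC (f @^-1` A) U_ultra.
by have [x [nAx Ax]] := clp (~` A) A UA Ap.
Qed.

Lemma nmsg_ge {R : realType} (n : nat) (r : R) : 2 `^ (n%:R * r) <= (nmsg n r)%:R :> R.
Proof.
rewrite natr_absz ger0_norm; first exact: ceil_ge.
by rewrite ceil_ge0 (lt_le_trans (ltrN10 R)) // powR_ge0.
Qed.

Lemma nmsg_gt0 {R : realType} (n : nat) (r : R) : (0 < nmsg n r)%N.
Proof. by rewrite -(ltr0n R) (lt_le_trans _ (nmsg_ge n r)) // powR_gt0. Qed.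

Lemma ln_nmsg_ge {R : realType} (n : nat) (r : R) :
  n%:R * (r * ln 2) <= ln (nmsg n r)%:R.
Proof.
rewrite mulrA -ln_powR ler_ln ?posrE ?nmsg_ge ?powR_gt0 // ltr0n; exact: nmsg_gt0.
Qed.

(** A single ultrafilter yields the limits at all input symbols at once. Both families of bounds are
    linear in the occupation measure, so one limit [P] satisfies them for every [q] and every
    [g]. *)
Lemma limit_input_law {R : realType} {S X Y Z : finType}
    (W : X -> S -> Y -> Z -> R) (QS : S -> R) (x0 : X) (r : R) :
  is_pmf QS -> is_channel W -> (forall z, 0 < Q0 W QS x0 z) ->
  sc_achievable W QS x0 r ->
  exists P : X -> R, [/\ is_pmf P,
    forall q : Y -> R, (forall y, 0 < q y) -> \sum_y q y = 1 ->
      r * ln 2 <= \sum_x P x * avgE W QS (fun x y _ => ln (outY W QS x y / q y)) x &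
    forall g : Z -> R, (forall z, 0 < g z) -> \sum_z Q0 W QS x0 z * g z = 1 ->
      \sum_x P x * avgE W QS (fun _ _ z => ln (g z)) x <= 0].
Proof.
move=> QS_pmf W_ch Q0_gt0 [c [err0 kl0]].
have [U [U_ultra subU]] := ultraFilterLemma (_ : ProperFilter \oo).
have U_proper : ProperFilter U := ultra_proper.
have toU (f : nat -> R) l : f @ \oo --> l -> f @ U --> l.
  by move=> fl A /fl; apply: subU.
(* The length is [n.+1], and [harmonic n] is its inverse; length zero, at which no normalization is
   possible, is left out. *)
pose p n x := harmonic n * occupation QS (c n.+1) x.
have p_ge0 n x : 0 <= p n x.
  by rewrite mulr_ge0 ?occupation_ge0 // /harmonic invr_ge0.
have p_sum n : \sum_x p n x = 1.
  by rewrite -mulr_sumr occupation_sum ?nmsg_gt0 // mulVf // pnatr_eq0.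
have p_le1 n x : p n x <= 1.
  by rewrite -(p_sum n) (bigD1 x) //= lerDl sumr_ge0.
have exP x : exists l : R, p n x @[n --> U] --> l.
  by apply: ultra_cvg_unit_interval => n; rewrite p_ge0 p_le1.
have [P pP] := choice exP.
have lin (h : X -> R) : \sum_x p n x * h x @[n --> U] --> \sum_x P x * h x.
  apply: cvg_big => [|x _]; first exact: add_continuous.
  by apply: cvgMr_tmp; apply: pP.
have harm0 (a : R) : harmonic n * a @[n --> U] --> (0 : R).
  rewrite -(mul0r a); apply: cvgMr_tmp; apply: toU; exact: cvg_harmonic.
exists P; split.
- split=> [x|].
    apply: (ler_cvg_to (@cvg_cst _ 0 _ U _) (pP x)); apply: nearW => n; exact: p_ge0.
  have h1 (f : X -> R) : \sum_x f x * 1 = \sum_x f x.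
    by apply: eq_bigr => x _; rewrite mulr1.
  have := lin (fun=> 1); under eq_cvg do rewrite h1 p_sum.
  rewrite h1 => /cvg_lim <- //; exact: lim_cst.
- move=> q q0 q1.
  set h := avgE _ _ _.
  have lhs : (1 - err_prob W QS (c n.+1)) * (r * ln 2) - harmonic n * ln 2
      @[n --> U] --> (1 - 0) * (r * ln 2) - 0.
    apply: cvgB; last exact: harm0.
    apply: cvgMr_tmp; apply: cvgB; first exact: cvg_cst.
    by apply: toU; move: err0; rewrite -(@cvg_shiftS _ (fun n => err_prob W QS (c n))).
  rewrite !subr0 mul1r in lhs.
  apply: (ler_cvg_to lhs (lin h)); apply: nearW => n.
  have n0 : 0 < n.+1%:R :> R by rewrite ltr0n.
  have Hc := converse_ineq W QS QS_pmf W_ch (c n.+1) (nmsg_gt0 _ _) q q0 q1.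
  (* This gives [1 - err] the sign needed to multiply the lower bound on [ln M] by it. *)
  have He := err_prob_le1 W QS QS_pmf W_ch (c n.+1) (nmsg_gt0 _ _).
  have nh : n.+1%:R * harmonic n = 1 :> R by rewrite /harmonic divff // gt_eqF.
  rewrite -(ler_pM2l n0) mulrBr [X in _ - X]mulrA nh mul1r mulr_sumr.
  under eq_bigr do rewrite /p !mulrA nh mul1r.
  apply: le_trans Hc; rewrite lerD2r mulrCA ler_wpM2l ?subr_ge0 //.
  exact: ln_nmsg_ge.
- move=> g g0 g1.
  set h := avgE _ _ _.
  have rhs : harmonic n * (ln 2 * KL (PZn W QS (c n.+1)) (Q0n W QS x0 (n:=n.+1)))
      @[n --> U] --> (0 * (ln 2 * 0) : R).
    apply: cvgM; first by apply: toU; exact: cvg_harmonic.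
    apply: cvgMl_tmp; apply: toU; move: kl0.
    by rewrite -(@cvg_shiftS _ (fun n => KL (PZn W QS (c n)) (Q0n W QS x0 (n:=n)))).
  rewrite mul0r in rhs.
  apply: (ler_cvg_to (lin h) rhs); apply: nearW => n.
  under eq_bigr do rewrite /p -mulrA.
  rewrite -mulr_sumr ler_wpM2l ?invr_ge0 //.
  by apply: covert_ineq => //; apply: nmsg_gt0.
Qed.

End Limit.

(** * Single-letter information quantities *)

Lemma ln_ge_1subV {R : realType} (t : R) : 0 < t -> 1 - t^-1 <= ln t.
Proof.
by move=> t0; rewrite -lerN2 opprB -lnV ?posrE // ln_le_sub1 // invr_gt0.
Qed.

Lemma ln2_gt0 {R : realType} : 0 < ln 2 :> R.
Proof. by rewrite ln_gt0 // ltr1n. Qed.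

Section SingleLetter.
Context {R : realType} {A B : finType}.
Variables (P : A -> R) (K : A -> B -> R).
Hypotheses (P_pmf : is_pmf P) (K_pmf : forall a, is_pmf (K a)).

Let P_ge0 a : 0 <= P a. Proof. by case: P_pmf. Qed.
Let K_ge0 a b : 0 <= K a b. Proof. by case: (K_pmf a). Qed.
Let K1 a : \sum_b K a b = 1. Proof. by case: (K_pmf a). Qed.

Let out b := \sum_a P a * K a b.

Let out_ge0 b : 0 <= out b.
Proof. by apply: sumr_ge0 => a _; apply: mulr_ge0. Qed.

Let out_sum1 : \sum_b out b = 1.
Proof.
rewrite exchange_big /=; under eq_bigr do rewrite -mulr_sumr K1 mulr1.
by case: P_pmf.
Qed.

Let pos a b : P a * K a b != 0 -> [/\ 0 < P a, 0 < K a b & 0 < out b].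
Proof.
move=> n0; have PK0 : 0 < P a * K a b by rewrite lt_def n0 mulr_ge0.
move: n0; rewrite mulf_eq0 negb_or => /andP[Pn Kn].
split; first by rewrite lt_def Pn P_ge0.
  by rewrite lt_def Kn K_ge0.
apply: lt_le_trans PK0 _; rewrite /out (bigD1 a) //= lerDl.
by apply: sumr_ge0 => a' _; apply: mulr_ge0.
Qed.

Lemma mutinfo_input_channel :
  ln 2 * mutinfo (fun a b => P a * K a b) =
  \sum_a \sum_b P a * K a b * ln (K a b / out b).
Proof.
rewrite /mutinfo mulr_sumr; apply: eq_bigr => a _.
rewrite big_mkcond mulr_sumr; apply: eq_bigr => b _ /=.
case: eqP => [->|/eqP n0] /=; first by rewrite mulr0 mul0r.
have [Pa Kab ob] := pos a b n0.
rewrite -mulr_sumr K1 mulr1 -/(out b) /log2 mulrCA [ln 2 * _]mulrC divfK ?gt_eqF ?ln2_gt0 //.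
by congr (_ * ln _); field; rewrite !gt_eqF.
Qed.

(** By [ln t >= 1 - 1 / t] each term is at least [P a * K a b - P a * out b], and these differences
    sum to zero. *)
Lemma mutinfo_input_ge0 : 0 <= mutinfo (fun a b => P a * K a b).
Proof.
rewrite -(pmulr_rge0 _ (@ln2_gt0 R)) mutinfo_input_channel.
apply: (@le_trans _ _ (\sum_a \sum_b (P a * K a b - P a * out b))).
  under eq_bigr do rewrite sumrB -!mulr_sumr K1 out_sum1 subrr.
  by rewrite big1.
apply: ler_sum => a _; apply: ler_sum => b _.
have [->|n0] := eqVneq (P a * K a b) 0.
  by rewrite mul0r sub0r oppr_le0 mulr_ge0.
have [Pa Kab ob] := pos a b n0.
have -> : P a * K a b - P a * out b = P a * K a b * (1 - (K a b / out b)^-1).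
  by field; rewrite !gt_eqF.
by rewrite ler_wpM2l ?mulr_ge0 // ln_ge_1subV // divr_gt0.
Qed.

(* The shift by [d] makes the reference output law positive everywhere, also
   outside the support of [out]. *)
Lemma cross_information_le (d : R) : 0 < d ->
  \sum_a P a * \sum_b K a b * ln (K a b / ((out b + d) / (1 + d * #|B|%:R)))
  <= ln 2 * mutinfo (fun a b => P a * K a b) + d * #|B|%:R.
Proof.
move=> d0; rewrite mutinfo_input_channel.
have N0 : 0 < 1 + d * #|B|%:R by rewrite ltr_pwDl // mulr_ge0 // ltW.
have dN : d * #|B|%:R = \sum_a \sum_b P a * K a b * (d * #|B|%:R).
  under eq_bigr do rewrite -mulr_suml -mulr_sumr K1 mulr1.
  by rewrite -mulr_suml; case: P_pmf => _ ->; rewrite mul1r.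
rewrite [X in _ <= _ + X]dN -big_split; apply: ler_sum => a _ /=; rewrite mulr_sumr -big_split.
apply: ler_sum => b _ /=; rewrite mulrA -mulrDr.
have [->|n0] := eqVneq (P a * K a b) 0; first by rewrite !mul0r.
have [Pa Kab ob] := pos a b n0.
rewrite ler_wpM2l ?mulr_ge0 //.
apply: (@le_trans _ _ (ln (K a b / out b * (1 + d * #|B|%:R)))); last first.
  rewrite lnM ?posrE ?divr_gt0 // lerD2l; apply: le_trans (ln_le_sub1 _ N0) _; lra.
have od : 0 < out b + d by rewrite addr_gt0.
rewrite ler_ln ?posrE ?divr_gt0 ?mulr_gt0 ?invr_gt0 ?divr_gt0 //.
rewrite invf_div -!mulrA ler_wpM2l // [leLHS]mulrC ler_wpM2r ?(ltW N0) //.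
by rewrite lef_pV2 ?posrE // lerDl ltW.
Qed.

(** The choice [q = out] would give the mutual information itself, but [out] may vanish at some
    letters. Strictly positive perturbations of [out] come within any [e] of it. *)
Lemma mutinfo_ge_of_cross_information (t : R) :
  (forall q : B -> R, (forall b, 0 < q b) -> \sum_b q b = 1 ->
    t * ln 2 <= \sum_a P a * \sum_b K a b * ln (K a b / q b)) ->
  t <= mutinfo (fun a b => P a * K a b).
Proof.
move=> H; rewrite -(ler_pM2r (@ln2_gt0 R)) [leRHS]mulrC.
apply/ler_addgt0Pr => e e0.
have N0 : 0 < 1 + #|B|%:R :> R by rewrite ltr_pwDl.
(* This makes the excess [d * #|B|] at most [e]; the [1 +] keeps the denominator positive for any
   cardinal. *)
pose d := e / (1 + #|B|%:R).
have d0 : 0 < d by rewrite divr_gt0.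
have dN0 : 0 < 1 + d * #|B|%:R by rewrite ltr_pwDl // mulr_ge0 // ltW.
apply: le_trans (H (fun b => (out b + d) / (1 + d * #|B|%:R)) _ _) _.
- by move=> b; rewrite divr_gt0 // ltr_wpDl.
- by rewrite -mulr_suml big_split /= out_sum1 sumr_const -[d *+ _]mulr_natr divff ?gt_eqF.
apply: le_trans (cross_information_le d d0) _; rewrite lerD2l.
by rewrite /d mulrAC ler_pdivrMr // mulrDr mulr1 lerDr ltW.
Qed.

End SingleLetter.

(** The test is the density with respect to [q] of the midpoint of [p] and [q], positive even where
    [p] vanishes. It forces a sum of the squares [(p / q - 1)^2] with positive weights to be
    zero. *)
Lemma pmf_eq_of_log_tests {R : realType} {B : finType} (p q : B -> R) :
  is_pmf p -> (forall b, 0 < q b) -> \sum_b q b = 1 ->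
  (forall g : B -> R, (forall b, 0 < g b) -> \sum_b q b * g b = 1 ->
     \sum_b p b * ln (g b) <= 0) ->
  p =1 q.
Proof.
move=> [p0 p1] q0 q1 H.
pose t b := p b / q b.
have t0 b : 0 <= t b by rewrite divr_ge0 // ltW.
have qt b : q b * t b = p b by rewrite /t; field; rewrite gt_eqF.
have g0 b : 0 < (t b + 1) / 2 by rewrite divr_gt0 // ltr_wpDl.
have g1 : \sum_b q b * ((t b + 1) / 2) = 1.
  have -> : \sum_b q b * ((t b + 1) / 2) = (\sum_b (p b + q b)) / 2.
    by rewrite mulr_suml; apply: eq_bigr => b _; rewrite -qt; ring.
  by rewrite big_split /= p1 q1; field.
(* [t ln ((t + 1) / 2) >= (t - 1) / 2 + (t - 1)^2 / (2 (t + 1))]. *)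
have dev_ge0 b : 0 <= q b * ((t b - 1) ^+ 2 / (2 * (t b + 1))).
  by rewrite mulr_ge0 ?(ltW (q0 b)) // divr_ge0 ?sqr_ge0 // mulr_ge0 // addr_ge0.
have dev0 : \sum_b q b * ((t b - 1) ^+ 2 / (2 * (t b + 1))) = 0.
  apply/eqP; rewrite eq_le sumr_ge0 // andbT; apply: le_trans (H _ g0 g1).
  (* Weighted by [q], the linear part [(t - 1) / 2] becomes [(p - q) / 2], whose sum is zero. *)
  rewrite -[leLHS]addr0 -[X in _ + X](_ : \sum_b (p b - q b) / 2 = 0); last first.
    by rewrite -mulr_suml sumrB p1 q1 subrr mul0r.
  rewrite -big_split; apply: ler_sum => b _ /=.
  apply: le_trans (ler_wpM2l (p0 b) (ln_ge_1subV _ (g0 b))).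
  rewrite -qt le_eqVlt; apply/orP; left; apply/eqP; field.
  by rewrite gt_eqF // ltr_wpDl.
move=> b; have /eqP := psumr_eq0P (fun b _ => dev_ge0 b) dev0 (i:=b) isT.
have t1 : 0 < 2 * (t b + 1) by rewrite mulr_gt0 // ltr_wpDl.
rewrite mulf_eq0 gt_eqF //= mulf_eq0 invr_eq0 (gt_eqF t1) orbF sqrf_eq0 subr_eq0.
by move=> /eqP tb; rewrite -qt tb mulr1.
Qed.

(** * The upper bound on the covert rate *)

Theorem theorem12 (R : realType) (S X Y Z : finType)
    (W : X -> S -> Y -> Z -> R) (QS : S -> R) (x0 : X) :
  is_pmf QS -> is_channel W ->
  (forall z : Z, 0 < Q0 W QS x0 z) ->
  forall r : R, sc_achievable W QS x0 r ->
    exists (k : nat) (PV : 'I_k -> R) (PXV : X -> 'I_k -> R),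
      in_D W QS x0 PV PXV /\ r <= mutinfo (PXY W QS PV PXV).
Proof.
move=> QS_pmf W_ch Q0_gt0 r r_ach.
have [P [P_pmf rate covert]] := limit_input_law W QS x0 r QS_pmf W_ch Q0_gt0 r_ach.
have [QS_ge0 QS1] := QS_pmf; have [P_ge0 P1] := P_pmf.
have W_ge0 := channel_ge0 W W_ch.
pose outZ x z := \sum_s QS s * \sum_y W x s y z.
have outZ_sum x : \sum_z outZ x z = 1.
  rewrite exchange_big -[RHS]QS1; apply: eq_bigr => s _ /=.
  by rewrite -mulr_sumr exchange_big /= channel_sum1 // mulr1.
have Q0_sum : \sum_z Q0 W QS x0 z = 1 := outZ_sum x0.
have outY_pmf x : is_pmf (outY W QS x).
  split=> [y|]; first exact: outY_ge0.
  rewrite exchange_big -[RHS]QS1; apply: eq_bigr => s _ /=.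
  by rewrite -mulr_sumr channel_sum1 // mulr1.
pose pz z := \sum_x P x * outZ x z.
have pzQ0 : pz =1 Q0 W QS x0.
  apply: pmf_eq_of_log_tests => //; first split.
  - move=> z; apply: sumr_ge0 => x _; rewrite mulr_ge0 // sumr_ge0 // => s _.
    by rewrite mulr_ge0 // sumr_ge0.
  - rewrite exchange_big -[RHS]P1; apply: eq_bigr => x _ /=.
    by rewrite -mulr_sumr outZ_sum mulr1.
  move=> g g0 g1; apply: le_trans (covert g g0 g1).
  rewrite le_eqVlt; apply/orP; left; apply/eqP.
  under eq_bigr do rewrite mulr_suml.
  rewrite exchange_big; apply: eq_bigr => x _ /=.
  under eq_bigr do rewrite -mulrA.
  rewrite -mulr_sumr; congr (_ * _).
  under eq_bigr do rewrite mulr_suml.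
  rewrite exchange_big; apply: eq_bigr => s _ /=.
  under eq_bigr do rewrite -mulrA mulr_suml.
  by rewrite -mulr_sumr exchange_big.
(* The auxiliary variable takes one value, and the limit law [P] serves as the law of [X] given that
   value. *)
exists 1%N, (fun=> 1), (fun x _ => P x).
have PXYE : PXY W QS (fun=> 1) (fun x (_ : 'I_1) => P x) =
    fun x y => P x * outY W QS x y.
  apply/funext => x; apply/funext => y.
  rewrite mulr_sumr; apply: eq_bigr => s _; rewrite big_ord1 !mulr_sumr.
  by apply: eq_bigr => z _; rewrite /aux_joint; ring.
have PVZE v z : PVZ W QS (fun=> 1) (fun x (_ : 'I_1) => P x) v z = Q0 W QS x0 z.
  rewrite -pzQ0 /PVZ [LHS]exchange_big; apply: eq_bigr => x _ /=.
  rewrite mulr_sumr; apply: eq_bigr => s _; rewrite !mulr_sumr.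
  by apply: eq_bigr => y _; rewrite /aux_joint; ring.
rewrite /in_D PXYE; split; last first.
  apply: mutinfo_ge_of_cross_information => // q q0 q1.
  apply: le_trans (rate q q0 q1) _; rewrite le_eqVlt; apply/orP; left; apply/eqP.
  apply: eq_bigr => x _; congr (_ * _).
  under [RHS]eq_bigr do rewrite mulr_suml.
  rewrite [RHS]exchange_big; apply: eq_bigr => s _ /=.
  under [RHS]eq_bigr do rewrite -mulrA mulr_suml.
  by rewrite -mulr_sumr.
split; first by apply/card_gt0P; exists x0.
split; first by split=> //; rewrite big_ord1.
split; first by [].
split=> [z|]; first by rewrite /PZ big_ord1 PVZE.
(* The joint law of [V] and [Z] is the product of its marginals, so every logarithm in [I(V;Z)] is
   taken at 1. *)
rewrite [leLHS](_ : _ = 0); first exact: mutinfo_input_ge0.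
rewrite /mutinfo big_ord1; apply: big1 => z _.
under eq_bigr do rewrite PVZE.
by rewrite big_ord1 !PVZE Q0_sum mul1r divff ?gt_eqF // /log2 ln1 mul0r mulr0.
Qed.
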